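(* Let $\mathbb{F}\in\{\mathbb{R},\mathbb{C}\}$, let $d\geq 1$, and let $p\in\mathbb{F}[x_1,\dots,x_n]$ be a polynomial of degree at most $d$, $$p(x_1,\dots,x_n)=\sum_{\substack{i_1,\dots,i_n\in\mathbb{Z}_{\ge0}\\ i_1+\cdots+i_n\le d}}\alpha_{i_1,\dots,i_n}x_1^{i_1}\cdots x_n^{i_n},\qquad \alpha_{i_1,\dots,i_n}\in\mathbb{F}.$$ Let $T\in S^d(\mathbb{F}^{n+1})$ be the symmetric tensor of order $d$ with $$T_{\underbrace{1\ldots1}_{i_1}\,\ldots\,\underbrace{n\ldots n}_{i_n}\,\underbrace{(n+1)\ldots(n+1)}_{i_{n+1}}}=\frac{\alpha_{i_1,\dots,i_n}}{\binom{d}{i_1,\dots,i_{n+1}}}$$ for all $i_1,\dots,i_{n+1}\in\mathbb{Z}_{\ge0}$ with $i_1+\cdots+i_{n+1}=d$, and let $r$ be the symmetric rank of $T$ over $\mathbb{F}$. Then: (i) If $m=\lfloor\log_2 d\rfloor+1$, then $p$ has a symmetric determinantal representation with matrices of size at most $2^{m-1}r^m(m+2)!$ with entries in $\mathbb{F}$. (ii) If $d=2^{m-1}$ for a positive integer $m$, then $p$ has a symmetric determinantal representation with matrices of size at most $(2r+2)^{m-1}$ with entries in $\mathbb{F}$.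
   Context: A symmetric determinantal representation (SDR) of $p\in\mathbb{F}[x_1,\dots,x_n]$ with matrices of size $N$ and entries in $\mathbb{F}$ is an expression $p=\det\left(A_0+\sum_{i=1}^n x_iA_i\right)$ with $A_0,\dots,A_n$ symmetric matrices in $\mathbb{F}^{N\times N}$. The symmetric rank of a symmetric tensor $T\in S^d(\mathbb{F}^{n+1})$ over $\mathbb{F}$ is the smallest positive integer $r$ such that $T=\sum_{i=1}^r\lambda_iw_i^{\otimes d}$ for some $\lambda_1,\dots,\lambda_r\in\mathbb{F}$ and $w_1,\dots,w_r\in\mathbb{F}^{n+1}$ (so the zero tensor is assigned $r=1$). *)

(* Defs.v *)
From mathcomp Require Import all_boot all_order all_algebra.
From mathcomp Require Import perm mpoly.

Set Implicit Arguments.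
Unset Strict Implicit.
Unset Printing Implicit Defensive.

Import GRing.Theory.
Local Open Scope ring_scope.

Definition has_SDR (F : fieldType) (n : nat) (p : {mpoly F[n]}) (N : nat) : Prop :=
  exists (A0 : 'M[F]_N) (A : 'I_n -> 'M[F]_N),
    [/\ A0^T = A0,
        forall i, (A i)^T = A i
      & p = \det (map_mx (@mpolyC n F) A0 +
                  \sum_(i < n) 'X_i *: map_mx (@mpolyC n F) (A i))].

(* Tensors of order d on F^n, as arrays of entries T_{j_1 ... j_d}. *)
Definition tensor (F : fieldType) (n d : nat) : Type :=
  {ffun d.-tuple 'I_n -> F}.

Definition symmetric_tensor (F : fieldType) (n d : nat) (T : tensor F n d) : Prop :=
  forall (s : 'S_d) (J : d.-tuple 'I_n), T [tuple tnth J (s k) | k < d] = T J.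

Definition tensor_power (F : fieldType) (n d : nat) (w : 'rV[F]_n) : tensor F n d :=
  [ffun J : d.-tuple 'I_n => \prod_(k < d) w 0 (tnth J k)].

Definition symmetric_decomposition (F : fieldType) (n d : nat)
    (T : tensor F n d) (r : nat) : Prop :=
  exists (lam : 'I_r -> F) (w : 'I_r -> 'rV[F]_n),
    T = [ffun J => \sum_(i < r) lam i * tensor_power d (w i) J].

(* r ranges over positive integers, so the zero tensor has rank 1. *)
Definition is_symmetric_rank (F : fieldType) (n d : nat)
    (T : tensor F n d) (r : nat) : Prop :=
  [/\ (0 < r)%N, symmetric_decomposition T r
    & forall s, (0 < s)%N -> symmetric_decomposition T s -> (r <= s)%N].

(* The multi-index 0...0 1...1 ... (n-1)...(n-1) in which k occurs i k times. *)
Definition sorted_index (n : nat) (i : 'X_{1..n}) : seq 'I_n :=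
  flatten [seq nseq (i k) k | k <- enum 'I_n].

(* The division is exact when mdeg i = d. *)
Definition multinomial_coef (n d : nat) (i : 'X_{1..n}) : nat :=
  (d`! %/ \prod_(k < n) (i k)`!)%N.

(* The exponents (i_1, ..., i_n) out of (i_1, ..., i_n, i_(n+1)); the last
   one is the exponent of the homogenizing variable. *)
Definition dehomog (n : nat) (i : 'X_{1..n.+1}) : 'X_{1..n} :=
  [multinom i (widen_ord (leqnSn n) k) | k < n].

(* Main.v *)
(** Comparing coefficients (characteristic 0 makes the multinomial coefficients
    invertible), a decomposition of [T] of length [r] says that [p] is a sum of
    [r] terms [lam_i l_i^d] with [l_i] affine.  Such a sum can be written
    [c + b B^-1 a] with [B], [a], [b], [c] affine, [det B = 1] and [B] of size
    [r (d - 1)].  The symmetric matrix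
    [[0, B, a], [B^T, 0, b^T], [a^T, b, -2c]] then has determinant
    [+- 2 (c + b B^-1 a)], by taking a Schur complement, and the constant is
    absorbed in the [lam_i].  The resulting size [2 r (d - 1) + 1] is below both
    bounds. *)
Require Import Defs.
From mathcomp Require Import all_boot all_order all_algebra.
From mathcomp Require Import mpoly complex reals.
From mathcomp Require Import zify ring.

Set Implicit Arguments.
Unset Strict Implicit.
Unset Printing Implicit Defensive.

Import GRing.Theory.
Local Open Scope ring_scope.

(** * Matrices with affine entries and representations [c + b B^-1 a] *)

Section AffineMatrices.
Variables (R : comNzRingType) (n : nat).
Implicit Types (p q : {mpoly R[n]}).

Definition affine_mx a b (M : 'M[{mpoly R[n]}]_(a, b)) :=
  forall i j, (msize (M i j) <= 2)%N.

(** Only the monomials [0] and [U_(k)] have degree at most 1. This splits a matrix with affine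
    entries into the constant matrices of an SDR. *)
Lemma msize_le2E p : (msize p <= 2)%N ->
  p = (p@_0%MM)%:MP + \sum_(k < n) 'X_k * (p@_U_(k)%MM)%:MP.
Proof.
move=> hp; apply/mpolyP => m; rewrite mcoeffD mcoeffC raddf_sum /=.
under eq_bigr do rewrite mulrC mcoeffCM mcoeffX.
case: (ltnP 1 (mdeg m)) => [m_gt1|].
  rewrite memN_msupp_eq0; last by apply: msize_mdeg_ge; apply: leq_trans m_gt1.
  rewrite -mdeg_eq0 gtn_eqF ?(ltnW m_gt1) // mulr0 add0r big1 // => k _.
  by case: eqP => [em|_]; [rewrite -em mdeg1 in m_gt1 | rewrite mulr0].
rewrite leq_eqVlt ltnS leqn0 mdeg_eq0 => /orP[/mdeg1P[k /eqP->]|/eqP->].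
  rewrite mnm1_eq0 mulr0 add0r (bigD1 k) //= eqxx mulr1 big1 ?addr0 // => j jk.
  case: eqP => [/mnmP /(_ j)|]; rewrite ?mulr0 // !mnm1E eqxx.
  by rewrite eq_sym (negPf jk).
rewrite eqxx mulr1 big1 ?addr0 // => k _.
by rewrite mnm1_eq0 mulr0.
Qed.

Lemma affine_mx0 a b : affine_mx (0 : 'M_(a, b)).
Proof. by move=> i j; rewrite mxE msize0. Qed.

Lemma affine_scalar_mx a p : (msize p <= 2)%N -> affine_mx (p%:M : 'M_a).
Proof. by move=> hp i j; rewrite mxE; case: eqP; rewrite ?mulr1n ?mulr0n ?msize0. Qed.

Lemma affine_mxD a b (A B : 'M_(a, b)) :
  affine_mx A -> affine_mx B -> affine_mx (A + B).
Proof.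
move=> hA hB i j; rewrite mxE (leq_trans (msizeD_le _ _)) //.
by rewrite geq_max hA hB.
Qed.

Lemma affine_mxN a b (A : 'M_(a, b)) : affine_mx A -> affine_mx (- A).
Proof. by move=> hA i j; rewrite mxE msizeN. Qed.

Lemma affine_trmx a b (A : 'M_(a, b)) : affine_mx A -> affine_mx A^T.
Proof. by move=> hA i j; rewrite mxE. Qed.

Lemma affine_row_mx a b1 b2 (A : 'M_(a, b1)) (B : 'M_(a, b2)) :
  affine_mx A -> affine_mx B -> affine_mx (row_mx A B).
Proof. by move=> hA hB i j; rewrite mxE; case: (split j). Qed.

Lemma affine_col_mx a1 a2 b (A : 'M_(a1, b)) (B : 'M_(a2, b)) :
  affine_mx A -> affine_mx B -> affine_mx (col_mx A B).
Proof. by move=> hA hB i j; rewrite mxE; case: (split i). Qed.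

Lemma affine_block_mx a1 a2 b1 b2 (A : 'M_(a1, b1)) (B : 'M_(a1, b2))
    (C : 'M_(a2, b1)) (D : 'M_(a2, b2)) :
  affine_mx A -> affine_mx B -> affine_mx C -> affine_mx D ->
  affine_mx (block_mx A B C D).
Proof. by move=> *; apply: affine_col_mx; apply: affine_row_mx. Qed.

(* [p = c + b B^-1 a] with affine data; [u] is the certificate [B^-1 a]. *)
Definition affine_rep K p := exists (B : 'M[{mpoly R[n]}]_K) (a : 'cV_K)
    (b : 'rV_K) (c : 'M_1) (u : 'cV_K),
  [/\ affine_mx B, affine_mx a, affine_mx b & affine_mx c] /\
  [/\ \det B = 1, B *m u = a & c + b *m u = p%:M].

Lemma affine_rep_affine p : (msize p <= 2)%N -> affine_rep 0 p.
Proof.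
move=> hp; exists 0, 0, 0, p%:M, 0; split.
  by split; try exact: affine_mx0; apply: affine_scalar_mx.
by split; rewrite ?det_mx00 ?mulmx0 ?addr0.
Qed.

Lemma affine_repD K1 K2 p q :
  affine_rep K1 p -> affine_rep K2 q -> affine_rep (K1 + K2) (p + q).
Proof.
move=> [B1 [a1 [b1 [c1 [u1 [[hB1 ha1 hb1 hc1] [dB1 eB1 ep]]]]]]].
move=> [B2 [a2 [b2 [c2 [u2 [[hB2 ha2 hb2 hc2] [dB2 eB2 eq]]]]]]].
exists (block_mx B1 0 0 B2), (col_mx a1 a2), (row_mx b1 b2), (c1 + c2),
  (col_mx u1 u2); split.
  split; [apply: affine_block_mx => //; exact: affine_mx0 | exact: affine_col_mx
         | exact: affine_row_mx | exact: affine_mxD].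
split; first by rewrite det_ublock dB1 dB2 mulr1.
  by rewrite mul_block_col !mul0mx addr0 add0r eB1 eB2.
by rewrite mul_row_col addrACA ep eq raddfD.
Qed.

(** One new unknown carries the value [p]: the added row of the system reads [- b u + t = c], which
    forces [t = c + b u = p]. The new output row then multiplies [t] by [l]. *)
Lemma affine_rep_mul K l p :
  (msize l <= 2)%N -> affine_rep K p -> affine_rep (K + 1) (l * p).
Proof.
move=> hl [B [a [b [c [u [[hB ha hb hc] [dB eB ep]]]]]]].
exists (block_mx B 0 (- b) 1%:M), (col_mx a c), (row_mx 0 l%:M), 0,
  (col_mx u p%:M); split.
  split; [apply: affine_block_mx | apply: affine_col_mx
         | apply: affine_row_mx | ] => //; try exact: affine_mx0.
  - exact: affine_mxN.
  - by apply: affine_scalar_mx; rewrite msize1.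
  - exact: affine_scalar_mx.
split; first by rewrite det_lblock dB det1 mulr1.
  by rewrite mul_block_col eB mul0mx addr0 mul1mx mulNmx -ep addrC addrK.
by rewrite mul_row_col mul0mx !add0r -scalar_mxM.
Qed.

(** The innermost factor [c *: l] is affine and needs no unknown, so the exponent [d.+1] costs only
    [d] of them. *)
Lemma affine_rep_scaled_exp l c d :
  (msize l <= 2)%N -> affine_rep d (c *: l ^+ d.+1).
Proof.
move=> hl; elim: d => [|d IHd].
  by rewrite expr1; apply: affine_rep_affine; rewrite (leq_trans (msizeZ_le _ _)).
by rewrite exprS scalerAr -[X in affine_rep X]addn1; apply: affine_rep_mul.
Qed.

Lemma affine_rep_sum r (K : 'I_r -> nat) (p : 'I_r -> {mpoly R[n]}) :
  (forall i, affine_rep (K i) (p i)) ->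
  affine_rep (\sum_(i < r) K i) (\sum_(i < r) p i).
Proof.
move=> hp; elim/big_rec2: _ => [|i k q _ hq]; last exact: affine_repD.
by apply: affine_rep_affine; rewrite msize0.
Qed.

End AffineMatrices.

(** * Symmetrization of affine representations *)

Lemma affine_symmetric_has_SDR (F : fieldType) n N (p : {mpoly F[n]})
    (M : 'M[{mpoly F[n]}]_N) :
  affine_mx M -> M^T = M -> \det M = p -> has_SDR p N.
Proof.
move=> hM sM <-.
exists (\matrix_(i, j) (M i j)@_0%MM),
  (fun k => \matrix_(i, j) (M i j)@_U_(k)%MM); split.
- by apply/matrixP => i j; rewrite !mxE -{1}sM mxE.
- by move=> k; apply/matrixP => i j; rewrite !mxE -{1}sM mxE.
congr (\det _); apply/matrixP => i j; rewrite !mxE summxE.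
by rewrite [LHS]msize_le2E //; congr (_ + _); apply: eq_bigr => k _; rewrite !mxE.
Qed.

(** The block swap is an involution. Its sign never has to be computed: knowing the square is enough
    to invert it. *)
Lemma det_antidiag_block_sqr (R : comNzRingType) K :
  \det (block_mx 0 1%:M 1%:M 0 : 'M[R]_(K + K)) ^+ 2 = 1.
Proof.
rewrite expr2 -det_mulmx mulmx_block !mulmx0 !mul0mx !mulmx1 !addr0 !add0r.
by rewrite -scalar_mx_block det1.
Qed.

(* The Schur complement of the symmetric block [[0, B], [B^T, 0]] doubles
   [b B^-1 a]: this is where characteristic 2 has to be excluded. *)
Lemma affine_rep_has_SDR (F : fieldType) n K (p : {mpoly F[n]}) :
  let eps := \det (block_mx 0 1%:M 1%:M 0 : 'M[F]_(K + K)) in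
  affine_rep K p -> has_SDR ((- 2%:R * eps) *: p) (K + K + 1).
Proof.
move=> eps [B [a [b [c [u [[hB ha hb hc] [dB eB ep]]]]]]].
pose D : 'M[{mpoly F[n]}]_(K + K) := block_mx 0 B B^T 0.
(* Since [B] has determinant 1, its adjugate is its inverse; [z] is the solution of [D z = v], found
   blockwise. *)
pose v := col_mx a b^T; pose x := (\adj B)^T *m b^T; pose z := col_mx x u.
have detD : \det D = eps%:MP.
  pose J : 'M[{mpoly F[n]}]_(K + K) := block_mx 0 1%:M 1%:M 0.
  have detJ : \det J = eps%:MP.
    rewrite /eps -det_map_mx; congr (\det _).
    by rewrite map_block_mx !map_mx1 !map_mx0.
  (* Swapping the block columns of [D] leaves the diagonal blocks [B] and [B^T], both of determinant
     1. *)
  have : \det D * \det J = 1.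
    rewrite -det_mulmx mulmx_block !mulmx0 !mul0mx !mulmx1 !addr0 !add0r.
    by rewrite det_lblock det_tr dB mulr1.
  move=> /(congr1 ( *%R^~ (\det J))).
  by rewrite -mulrA -expr2 det_antidiag_block_sqr mulr1 mul1r detJ.
have eBx : B^T *m x = b^T.
  by rewrite mulmxA -trmx_mul mul_adj_mx dB tr_scalar_mx mul1mx.
have eDz : D *m z = v by rewrite mul_block_col !mul0mx add0r addr0 eB eBx.
have tr11 (A : 'M[{mpoly F[n]}]_1) : A^T = A by rewrite [A]mx11_scalar tr_scalar_mx.
(* The two halves are [a^T x] and [b u]; the first equals the second after transposing a 1 by 1
   matrix. *)
have evz : v^T *m z = b *m u + b *m u.
  rewrite tr_col_mx trmxK mul_row_col; congr (_ + _).
  rewrite -[LHS]tr11 !trmx_mul !trmxK -eB -mulmxA (mulmxA _ B) mul_adj_mx dB.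
  by rewrite mul1mx.
pose M := block_mx D v v^T (- (c + c)).
apply: (@affine_symmetric_has_SDR _ _ _ _ M).
- have hv : affine_mx v by apply: affine_col_mx => //; apply: affine_trmx.
  apply: affine_block_mx => //; last 2 first.
  + exact: affine_trmx.
  + by apply: affine_mxN; apply: affine_mxD.
  by apply: affine_block_mx; try exact: affine_mx0; rewrite ?affine_trmx //;
    apply: affine_trmx.
- by rewrite tr_block_mx trmxK tr11 tr_block_mx trmxK !trmx0.
(* Column elimination by a unipotent matrix: the corner becomes the Schur complement
   [- (c + c) - v^T z], which is [- 2 p]. *)
have : M *m block_mx 1%:M (- z) 0 1%:M = block_mx D 0 v^T ((- 2%:R * p)%:M).
  rewrite mulmx_block !mulmx1 !mulmx0 !addr0 !mulmxN eDz evz addNr.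
  congr (block_mx _ _ _ _); rewrite -opprD mulNr raddfN /= mulr_natl raddfMn /=.
  by rewrite -ep mulr2n addrACA [b *m u + _]addrC [c + _]addrC.
move=> /(congr1 determinant); rewrite det_mulmx det_ublock !det1 !mulr1 => ->.
rewrite det_lblock detD det_scalar1 -mul_mpolyC rmorphM rmorphN rmorph_nat /=.
by rewrite mulrCA mulrA.
Qed.

(** * Coefficients of powers of affine forms *)

Section PowersOfAffineForms.
Variables (R : comNzRingType) (n : nat).
Implicit Types (w : 'rV[R]_n.+1) (m : 'X_{1..n}).

(** The linear form with coefficient vector [w], its last variable set to 1. *)
Definition affine_form w : {mpoly R[n]} :=
  \sum_(k < n) (w 0 (widen_ord (leqnSn n) k))%:MP * 'X_k + (w 0 ord_max)%:MP.

Lemma msize_affine_form w : (msize (affine_form w) <= 2)%N.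
Proof.
apply: leq_trans (msizeD_le _ _) _; rewrite geq_max; apply/andP; split; last first.
  by rewrite msizeC; case: eqP.
apply: leq_trans (msize_sum _ _ _) _; apply/bigmax_leqP => k _.
by rewrite mul_mpolyC (leq_trans (msizeZ_le _ _)) // msizeX mdeg1.
Qed.

Lemma mderivXn (p : {mpoly R[n]}) k d :
  (p ^+ d.+1)^`M(k) = (p^`M(k) * p ^+ d) *+ d.+1.
Proof.
elim: d => [|d IHd]; first by rewrite expr1 expr0 mulr1.
by rewrite exprS mderivM IHd mulrnAr mulrCA -exprS [RHS]mulrS.
Qed.

Lemma mderiv_affine_form w k :
  (affine_form w)^`M(k) = (w 0 (widen_ord (leqnSn n) k))%:MP.
Proof.
rewrite mderivD mderivC addr0 raddf_sum /= (bigD1 k) //= big1 => [|j jk].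
  by rewrite mderiv_mulC mderivX mnm1E eqxx scale1r -{1}[U_(k)%MM]add0m addmK mpolyX0 mulr1 addr0.
by rewrite mderiv_mulC mderivX mnm1E (negPf jk) scale0r mulr0.
Qed.

(** The multinomial theorem with denominators cleared, hence valid over any commutative ring. The
    induction on the degree of [m] differentiates in a variable that occurs in [m]. *)
Lemma mcoeff_affine_form_exp w d m : (mdeg m <= d)%N ->
  ((\prod_(k < n) (m k)`!) * (d - mdeg m)`!)%:R * (affine_form w ^+ d)@_m =
  d`!%:R * (\prod_(k < n) w 0 (widen_ord (leqnSn n) k) ^+ m k
            * w 0 ord_max ^+ (d - mdeg m)).
Proof.
elim: {m}(mdeg m) {-2}m (erefl (mdeg m)) d => [|s IHs] m hm d.
  move=> _; have -> : m = 0%MM by apply/eqP; rewrite -mdeg_eq0 hm.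
  rewrite big1 => [|k _]; last by rewrite mnm0E.
  rewrite big1 => [|k _]; last by rewrite mnm0E expr0.
  rewrite mdeg0 subn0 mul1n mul1r; congr (_ * _).
  rewrite rmorphXn /= /affine_form mcoeffD mcoeffC eqxx mulr1 raddf_sum /=.
  rewrite big1 ?add0r // => k _.
  by rewrite mcoeffCM mcoeffX mnm1_eq0 mulr0.
case: d => [|d]; rewrite hm // ltnS subSS => hs.
have [k mk] : exists k, (0 < m k)%N.
  apply/existsP; apply: contraTT isT; rewrite negb_exists => /forallP m0.
  suff: mdeg m = 0%N by rewrite hm.
  by rewrite mdegE big1 // => k _; apply/eqP; rewrite -leqn0 leqNgt.
pose m' := (m - U_(k))%MM.
have em : m = (m' + U_(k))%MM.
  by rewrite submK //; apply/mnm_lepP => j; rewrite mnm1E; case: eqP => // <-.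
have hm' : mdeg m' = s by move: hm; rewrite em mdegD mdeg1 addn1 => -[].
have mE j : j != k -> m j = m' j.
  by move=> jk; rewrite em mnmDE mnm1E eq_sym (negPf jk) addn0.
have mkE : m k = (m' k).+1 by rewrite em mnmDE mnm1E eqxx addn1.
have := IHs m' hm' d; rewrite hm' => /(_ hs).
rewrite (bigD1 k) //= [in X in _ = X -> _](bigD1 k) //=.
rewrite [in X in _ -> X = _](bigD1 k) //= [in X in _ -> _ = X](bigD1 k) //=.
have -> : (\prod_(i < n | i != k) (m i)`! = \prod_(i < n | i != k) (m' i)`!)%N.
  by apply: eq_bigr => j /mE ->.
have -> : \prod_(i < n | i != k) w 0 (widen_ord (leqnSn n) i) ^+ m i =
          \prod_(i < n | i != k) w 0 (widen_ord (leqnSn n) i) ^+ m' i.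
  by apply: eq_bigr => j /mE ->.
(* The coefficient at [m'] of the derivative, computed in two ways, ties the coefficient of the
   power [d.+1] at [m] to that of the power [d] at [m']; the factors [(m' k).+1] and [d.+1] complete
   the factorials. *)
have := mcoeff_deriv k m' (affine_form w ^+ d.+1).
rewrite -em mderivXn mderiv_affine_form mcoeffMn mcoeffCM -[_ *+ (m' k).+1]mulr_natl.
set c := (_ ^+ d)@_m'; set c' := (_ ^+ d.+1)@_m.
rewrite mkE !factS !natrM exprS => e1 e2.
rewrite -!mulrA mulrC -!mulrA [c' * _]mulrC -e1.
move: e2; set P := (\prod_(i < n | _) _)%:R; set Q := \prod_(i < n | _) _ => e2.
transitivity (d.+1%:R * w 0 (widen_ord (leqnSn n) k) *
  ((m' k)`!%:R * P * (d - s)`!%:R * c)); last by rewrite e2; ring.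
ring.
Qed.

End PowersOfAffineForms.

(** * Sorted indices, multinomial coefficients and homogenized exponents *)

Lemma prodr_sorted_index (R : comNzRingType) n (i : 'X_{1..n}) (f : 'I_n -> R) :
  \prod_(j <- sorted_index i) f j = \prod_(k < n) f k ^+ i k.
Proof.
rewrite /sorted_index big_flatten big_map big_enum /=.
by apply: eq_bigr => k _; rewrite big_nseq iter_mulr_1.
Qed.

Lemma size_sorted_index n (i : 'X_{1..n}) : size (sorted_index i) = mdeg i.
Proof.
rewrite /sorted_index size_flatten /shape -map_comp sumnE big_map big_enum mdegE.
by apply: eq_bigr => k _; rewrite /= size_nseq.
Qed.

(** A multinomial coefficient is a product of binomial ones. This makes the integer division in
    [multinomial_coef] exact. *)
Lemma dvdn_prod_fact n (f : 'I_n -> nat) :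
  (\prod_(k < n) (f k)`! %| (\sum_(k < n) f k)`!)%N.
Proof.
elim/big_rec2: _ => // k s q _ IH.
by rewrite -(bin_fact (leq_addr s (f k))) addKn dvdn_mull // dvdn_mul.
Qed.

(** A section of [dehomog]: the homogenizing variable, at [ord_max], receives the missing degree.
    The subtraction is truncated, so the total is [d] only when [mdeg m <= d]. *)
Definition homog_exp n d (m : 'X_{1..n}) : 'X_{1..n.+1} :=
  [multinom oapp m (d - mdeg m)%N (unlift ord_max k) | k < n.+1].

Lemma homog_exp_widen n d (m : 'X_{1..n}) k :
  homog_exp d m (widen_ord (leqnSn n) k) = m k.
Proof.
rewrite mnmE (_ : widen_ord _ k = lift ord_max k) ?liftK //.
by apply: val_inj; exact: esym (lift_max k).
Qed.

Lemma homog_exp_max n d (m : 'X_{1..n}) : homog_exp d m ord_max = (d - mdeg m)%N.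
Proof. by rewrite mnmE unlift_none. Qed.

Lemma dehomog_homog_exp n d (m : 'X_{1..n}) : dehomog (homog_exp d m) = m.
Proof. by apply/mnmP => k; rewrite mnmE homog_exp_widen. Qed.

Lemma mdeg_homog_exp n d (m : 'X_{1..n}) :
  (mdeg m <= d)%N -> mdeg (homog_exp d m) = d.
Proof.
move=> hm; rewrite mdegE big_ord_recr /= homog_exp_max -[RHS](subnKC hm) mdegE.
by congr (_ + _)%N; apply: eq_bigr => k _; rewrite homog_exp_widen.
Qed.

Lemma msize_exp_le (R : idomainType) n (p : {mpoly R[n]}) d :
  (msize p <= 2)%N -> (msize (p ^+ d) <= d.+1)%N.
Proof.
move=> hp; elim: d => [|d IHd]; first by rewrite expr0 msize1.
have [->|p0] := eqVneq p 0; first by rewrite expr0n msize0.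
by rewrite exprS msizeM ?expf_neq0 //; lia.
Qed.

(** * From tensor decompositions to sums of powers, and the size bounds *)

Lemma sum_powers_of_decomposition (F : fieldType) n d (p : {mpoly F[n]})
    (T : tensor F n.+1 d) r (lam : 'I_r -> F) (w : 'I_r -> 'rV[F]_n.+1) :
  [pchar F] =i pred0 -> (msize p <= d.+1)%N ->
  (forall (i : 'X_{1..n.+1}) (J : d.-tuple 'I_n.+1),
     mdeg i = d -> tval J = sorted_index i ->
     T J = p@_(dehomog i) / (multinomial_coef d i)%:R) ->
  T = [ffun J => \sum_(i < r) lam i * tensor_power d (w i) J] ->
  p = \sum_(i < r) lam i *: affine_form (w i) ^+ d.
Proof.
move=> /pcharf0P char0 hp hT eT; apply/mpolyP => m; rewrite raddf_sum /=.
case: (leqP (mdeg m) d) => [hm|m_gtd]; last first.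
  rewrite memN_msupp_eq0 ?msize_mdeg_ge ?(leq_trans hp) //.
  rewrite big1 // => i _; rewrite mcoeffZ memN_msupp_eq0 ?mulr0 //.
  apply: msize_mdeg_ge; apply: leq_trans m_gtd.
  exact/msize_exp_le/msize_affine_form.
set i := homog_exp d m; have hi : mdeg i = d by exact: mdeg_homog_exp.
have szJ : size (sorted_index i) == d by rewrite size_sorted_index hi.
have := hT i (Tuple szJ) hi erefl.
rewrite dehomog_homog_exp eT ffunE => eqT.
have facE : (\prod_(k < n.+1) (i k)`! = \prod_(k < n) (m k)`! * (d - mdeg m)`!)%N.
  rewrite big_ord_recr /= homog_exp_max; congr (_ * _)%N.
  by apply: eq_bigr => k _; rewrite homog_exp_widen.
have coefE : (multinomial_coef d i * \prod_(k < n.+1) (i k)`! = d`!)%N.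
  by rewrite divnK //; have := dvdn_prod_fact i; rewrite -mdegE hi.
have fac0 : (\prod_(k < n.+1) (i k)`!)%:R != 0 :> F.
  by rewrite char0 -lt0n prodn_gt0 // => k; rewrite fact_gt0.
have coef0 : (multinomial_coef d i)%:R != 0 :> F.
  rewrite char0; apply: contraTneq (fact_gt0 d) => c0.
  by rewrite -coefE c0 mul0n.
(* Divided by the multinomial coefficient, the left side is an entry of [T], so the decomposition
   allows a comparison term by term. *)
apply: (mulIf (invr_neq0 coef0)); rewrite -eqT mulr_suml.
apply: eq_bigr => j _; rewrite mcoeffZ -mulrA; congr (_ * _).
apply: (mulfI fac0); rewrite mulrA [in RHS]facE mcoeff_affine_form_exp //.
rewrite ffunE -(big_tuple _ _ _ xpredT (fun k => w j 0 k)) /= prodr_sorted_index.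
have -> : \prod_(k < n.+1) w j 0 k ^+ i k =
  \prod_(k < n) w j 0 (widen_ord (leqnSn n) k) ^+ m k
  * w j 0 ord_max ^+ (d - mdeg m).
  rewrite big_ord_recr /= homog_exp_max; congr (_ * _).
  by apply: eq_bigr => k _; rewrite homog_exp_widen.
by rewrite -coefE natrM [RHS]mulrC !mulrA mulVf // mul1r.
Qed.

(* Each summand costs [d - 1] inner nodes, doubled by the symmetrization. *)
Lemma sum_powers_has_SDR (F : fieldType) n d r (lam : 'I_r -> F)
    (l : 'I_r -> {mpoly F[n]}) :
  2%:R != 0 :> F -> (forall i, (msize (l i) <= 2)%N) ->
  has_SDR (\sum_(i < r) lam i *: l i ^+ d.+1) (2 * (r * d) + 1).
Proof.
move=> two0 hl; set K := (r * d)%N.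
pose eps := \det (block_mx 0 1%:M 1%:M 0 : 'M[F]_(K + K)).
have eps2 : eps ^+ 2 = 1 by exact: det_antidiag_block_sqr.
have eps0 : eps != 0.
  by apply: contra_eq_neq eps2 => ->; rewrite expr0n eq_sym oner_eq0.
(* Scaling the summands by [c] beforehand cancels the factor [- 2 eps] created by the
   symmetrization. *)
pose c := (- 2%:R * eps)^-1.
have c0 : - 2%:R * eps != 0 by rewrite mulf_neq0 // oppr_eq0.
have rep : affine_rep K (\sum_(i < r) (c * lam i) *: l i ^+ d.+1).
  rewrite /K -[r in (r * d)%N]card_ord -sum_nat_const.
  by apply: affine_rep_sum => i; apply: affine_rep_scaled_exp.
have := affine_rep_has_SDR rep; rewrite -/eps scaler_sumr mul2n -addnn.
under eq_bigr do rewrite scalerA mulrA divff // mul1r.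
by [].
Qed.

Theorem theorem4p7 (R : realType) (F : fieldType)
    (hF : F = (R : fieldType) \/ F = (R[i] : fieldType))
    (n d : nat) (hd : (1 <= d)%N)
    (p : {mpoly F[n]}) (hp : (msize p <= d.+1)%N)
    (T : tensor F n.+1 d) (hTsym : symmetric_tensor T)
    (hT : forall (i : 'X_{1..n.+1}) (J : d.-tuple 'I_n.+1),
        mdeg i = d -> tval J = sorted_index i ->
        T J = p@_(dehomog i) / (multinomial_coef d i)%:R)
    (r : nat) (hr : is_symmetric_rank T r) :
  (forall m : nat, m = (trunc_log 2 d + 1)%N ->
     exists N : nat, [/\ (0 < N)%N,
       (N <= 2 ^ (m - 1) * r ^ m * (m + 2)`!)%N & has_SDR p N])
  /\
  (forall m : nat, (0 < m)%N -> d = (2 ^ (m - 1))%N ->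
     exists N : nat, [/\ (0 < N)%N,
       (N <= (2 * r + 2) ^ (m - 1))%N & has_SDR p N]).
Proof.
have char0 : [pchar F] =i pred0.
  by case: hF => ->; apply: Num.Theory.pchar_num.
have [r0 [lam [w eT]] _] := hr.
have SDR : has_SDR p (2 * (r * d.-1) + 1).
  rewrite (sum_powers_of_decomposition char0 hp hT eT) -{1}(prednK hd).
  apply: sum_powers_has_SDR => [|i]; last exact: msize_affine_form.
  by move/pcharf0P: char0 => ->.
split=> [m em | m m0 ed]; exists (2 * (r * d.-1) + 1)%N;
  (split=> //; first by rewrite addn1).
- case: m em => [|m]; first by rewrite addn1.
  rewrite addn1 => -[em]; rewrite subn1 /=.
  have dlt : (d < 2 ^ m.+1)%N by rewrite em; apply: trunc_log_ltn.
  have hfact : (4 <= (m.+1 + 2)`!)%N.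
    by apply: (@leq_trans 3`!) => //; apply: leq_fact; lia.
  have hpow : (r <= r ^ m.+1)%N by rewrite expnS leq_pmulr // expn_gt0 r0.
  (* With [m] shifted by one, [d < 2 * 2 ^ m], so [2 r (d - 1) + 1 <= 2 r d <= 4 r 2 ^ m]; the
     factorial is only used to supply the 4. *)
  apply: (@leq_trans (2 ^ m * r * 4)); last by rewrite leq_mul // leq_mul.
  by rewrite expnS in dlt; nia.
- case: m m0 ed => // m _; rewrite subn1 /= => ed.
  have -> : ((2 * r + 2) ^ m = d * r.+1 ^ m)%N.
    by rewrite ed -expnMn; congr (_ ^ _)%N; lia.
  (* For [d = 1] both sides are 1, and for [d = 2] the claim is [2 r + 1 <= 2 r + 2]. Beyond that,
     [(r + 1) ^ 2 >= 2 r + 1] suffices. *)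
  case: m ed => [|[|m]] ed.
  + by rewrite ed expn0 muln0.
  + by rewrite ed !expn1; lia.
  have : (r.+1 ^ 2 <= r.+1 ^ m.+2)%N by rewrite leq_exp2l.
  by rewrite expnS expn1; nia.
Qed.
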